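(* Let $n \geqslant 2$ be an integer, let $N = 2n+3$, and work in the ring $\mathbb{Z}[x]/(x^{N}-1)$, whose elements are represented by polynomials of degree less than $N$. Put $$P=\sum_{i=0}^{n}x^i,\qquad Q=\sum_{i=0}^{2n+2}x^i,\qquad R=Q-x^{n-1}-x^{2n+1},\qquad S=Q-1-x^2-x^{n+2}-x^{n+3}.$$ Let $A_n(x)$ be the $9\times 9$ matrix over $\mathbb{Z}[x]/(x^{N}-1)$ $$ A_n(x)=\left( \begin{array}{ccccccccc} 0 & P & xP & x^{n-1}P & x^{n-2}P & x^{2n} & x(1+x^n) & x^2P & xP \\ 0 & xP & x^2P & x^nP & x^{n-1}P & x^{2n+1} & x^2(1+x^n) & x^3P & x^2P \\ 0 & x^2P & x^3P & x^{n+1}P & x^nP & x^{2n+2} & x^3(1+x^n) & x^4P & x^3P \\ 0 & x^3P & x^4P & x^{n+2}P & x^{n+1}P & 1 & x^4(1+x^n) & x^5P & x^4P \\ 0 & x^4P & x^5P & x^{n+3}P & x^{n+2}P & x & x^5(1+x^n) & x^6P & x^5P \\ 0 & x^5P & x^6P & x^{n+4}P & x^{n+3}P & x^2 & x^6(1+x^n) & x^7P & x^6P \\ Q & 1 & x & x^{n-1} & x^{n-2} & R & S & x^2 & x \\ Q & 1 & x & x^{n-1} & x^{n-2} & R & S & x^2 & x \\ Q & 1 & x & x^{n-1} & x^{n-2} & R & S & x^2 & x \end{array} \right). $$ Then the digraph on $9(2n+3)$ vertices whose adjacency matrix is the decompactification of $A_n(x)$ is a strongly regular digraph with parameter set $(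9(2n+3),\,3(2n+3),\,2n+4,\,2n+1,\,2n+4)$.
   Context: Digraphs are directed graphs without loops and without multiple arcs in the same direction (arcs $i\to j$ and $j\to i$ may both be present). The adjacency matrix of a digraph with vertices $1,\dots,v$ is the $v\times v$ matrix whose $(i,j)$ entry is $1$ if there is an arc from $i$ to $j$, and $0$ otherwise. Strongly regular digraph: a digraph on $v$ vertices is strongly regular with parameter set $(v,k,t,\lambda,\mu)$, written $\text{dsrg}(v,k,t,\lambda,\mu)$, if (1) every vertex has outdegree and indegree equal to $k$; (2) for each vertex $x$ there are exactly $t$ paths of the form $x\to z\to x$; (3) if there is an arc from $x$ to $y\neq x$, there are exactly $\lambda$ paths of the form $x\to z\to y$; (4) if there is no arc from $x$ to $y\neq x$, there are exactly $\mu$ paths of the form $x\to z\to y$. Equivalently, its adjacency matrix $A$ satisfies $A^2=tI_v+\lambda A+\mu(J_v-I_v-A)$ and $AJ_v=J_vA=kJ_v$, where $I_v$ is the identity matrix of order $v$ and $J_v$ is the all-ones matrix of order $v$. Circulants: a circulant matrix of order $N$ is a square matrix in which each row, starting from the second, is the cyclic right shift by one position of the preceding row. The ring of integer circulant matrices of order $N$ is isomorphic to $\mathbb{Z}[x]/(x^N-1)$, where the circulant with first row $(a_1,a_2,\dots,a_N)$ corresponds to the polynomial $a_1+a_2x+\dots+a_Nx^{N-1}$. Compactification and decompactification: for a block matrix $M$ all of whose blocks are circulants of order $N$, its compactification $M(x)$ is the matrix obtained by replacing each block with the corresponding polynomial under this isomorphism. Decompactification is the inverse operation: each polynomial entry (reduced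 modulo $x^N-1$ to degree less than $N$) is replaced by the corresponding circulant block of order $N$. Here $N=2n+3$, so a $9\times 9$ polynomial matrix decompactifies to a square matrix of order $9(2n+3)$. *)

(* Defs.v *)
From mathcomp Require Export all_boot all_order all_algebra.
From mathcomp Require Export qpoly.

Set Implicit Arguments.
Unset Strict Implicit.
Unset Printing Implicit Defensive.

Import GRing.Theory.
Local Open Scope ring_scope.

Record digraph (V : finType) := Digraph {
  arc : rel V;
  arc_irrefl : irreflexive arc
}.

Definition adjacency_matrix (v : nat) (G : digraph 'I_v) : 'M[int]_v :=
  \matrix_(i, j) (arc G i j)%:R.

Section StronglyRegular.
Variables (V : finType) (G : digraph V).

Definition outdegree (x : V) : nat := #|[set y | arc G x y]|.
Definition indegree (x : V) : nat := #|[set y | arc G y x]|.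

(* A path x -> z -> y is determined by its middle vertex z. *)
Definition paths2 (x y : V) : nat := #|[set z | arc G x z && arc G z y]|.

Definition dsrg (v k t l m : nat) : Prop :=
  [/\ #|V| = v,
      forall x, outdegree x = k /\ indegree x = k,
      forall x, paths2 x x = t,
      forall x y, x != y -> arc G x y -> paths2 x y = l
    & forall x y, x != y -> ~~ arc G x y -> paths2 x y = m].

End StronglyRegular.

(* Z[x]/(x^N - 1). The library's {poly %/ h} is the intended quotient only for
   h monic and nonconstant, that is, here, for 0 < N; its elements are stored
   as their representatives of degree less than N. *)
Notation circ_ring N := {poly %/ ('X^N - 1 : {poly int})}.

(* The circulant with first row p`_0, ..., p`_N.-1; row i is the first row
   shifted i positions to the right, so the index below is j - i mod N. *)
Definition circulant (N : nat) (p : circ_ring N) : 'M[int]_N :=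
  \matrix_(i, j) (p : {poly int})`_((j + (N - i)) %% N).

Definition decompactification (N b : nat) (M : 'M[circ_ring N]_b) :
    'M[int]_(\sum_(i < b) N) :=
  \mxblock_(i < b, j < b) circulant (M i j).

Definition mx9_of_rows (R : nmodType) (rows : seq (seq R)) : 'M[R]_9 :=
  \matrix_(i, j) (nth [::] rows i)`_j.

Definition A_mx (n : nat) : 'M[circ_ring (2 * n + 3)]_9 :=
  let x : circ_ring (2 * n + 3) := 'qX in
  let P := \sum_(0 <= i < n.+1) x ^+ i in
  let Q := \sum_(0 <= i < 2 * n + 3) x ^+ i in
  let R := Q - x ^+ (n - 1) - x ^+ (2 * n + 1) in
  let S := Q - 1 - x ^+ 2 - x ^+ (n + 2) - x ^+ (n + 3) in
  mx9_of_rows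
  [:: [:: 0; P;          x * P;      x ^+ (n - 1) * P; x ^+ (n - 2) * P;
          x ^+ (2 * n);     x * (1 + x ^+ n);      x ^+ 2 * P; x * P];
      [:: 0; x * P;      x ^+ 2 * P; x ^+ n * P;       x ^+ (n - 1) * P;
          x ^+ (2 * n + 1); x ^+ 2 * (1 + x ^+ n); x ^+ 3 * P; x ^+ 2 * P];
      [:: 0; x ^+ 2 * P; x ^+ 3 * P; x ^+ (n + 1) * P; x ^+ n * P;
          x ^+ (2 * n + 2); x ^+ 3 * (1 + x ^+ n); x ^+ 4 * P; x ^+ 3 * P];
      [:: 0; x ^+ 3 * P; x ^+ 4 * P; x ^+ (n + 2) * P; x ^+ (n + 1) * P;
          1;                x ^+ 4 * (1 + x ^+ n); x ^+ 5 * P; x ^+ 4 * P];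
      [:: 0; x ^+ 4 * P; x ^+ 5 * P; x ^+ (n + 3) * P; x ^+ (n + 2) * P;
          x;                x ^+ 5 * (1 + x ^+ n); x ^+ 6 * P; x ^+ 5 * P];
      [:: 0; x ^+ 5 * P; x ^+ 6 * P; x ^+ (n + 4) * P; x ^+ (n + 3) * P;
          x ^+ 2;           x ^+ 6 * (1 + x ^+ n); x ^+ 7 * P; x ^+ 6 * P];
      [:: Q; 1; x; x ^+ (n - 1); x ^+ (n - 2); R; S; x ^+ 2; x];
      [:: Q; 1; x; x ^+ (n - 1); x ^+ (n - 2); R; S; x ^+ 2; x];
      [:: Q; 1; x; x ^+ (n - 1); x ^+ (n - 2); R; S; x ^+ 2; x]].

(* Main.v *)
From HB Require Import structures.
Require Import Defs.
From mathcomp Require Import zify ring.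

(** The idea is that the compact matrix A has rank one modulo
    Q = 1 + x + ... + x^(N-1), where N = 2n+3; this is the element that every power of x fixes.

    Its first six rows are x^i times one row t, and its last three rows are all
    equal to one row w.  Since x = s^2 with s = x^(n+2), and
    P (1 + s) = Q - s^(-1), one finds t = P w + Q c for a row c of integers
    (lemma [top_rowE]).  Hence A = v w + Q a c, where v has entries x^i P in
    the first six rows and 1 in the others, and a is the indicator of the
    first six rows (lemma [compact_entryE]).  The scalar w v is
    (2n+4) Q - 3 (lemma [row_col_product]), so A^2 = -3 A modulo Q: it remains
    to identify the multiple of Q.  As Q p = p(1) Q for each p, this is
    arithmetic with values at x = 1, where w becomes 1 - 2 c and v becomes
    1 + n a.  The result is

      A^2 + 3 A = (2n+4) Q J,   A (Q J) = (Q J) A = 3 N (Q J),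

    where J is the all-ones matrix of order 9 (lemmas [A_mx_sqr],
    [A_mx_row_sum], [A_mx_col_sum]).

    Decompactification is additive and multiplicative (lemma
    [decompactificationM]), and it sends Q J to the all-ones matrix of order
    9 N, so the three identities hold for the decompactification M.  The
    entries of A have coefficients 0 and 1, and the constant coefficients on
    its diagonal vanish; so M is the adjacency matrix of a digraph.
    Comparing entries in M^2 = (2n+4) J - 3 M gives 2n+4 paths from x to y, or
    2n+1 of them when there is an arc (lemma [dsrg_of_adjacency]). *)

Set Implicit Arguments.
Unset Strict Implicit.
Unset Printing Implicit Defensive.
Import GRing.Theory Num.Theory Pdiv.Ring Pdiv.RingMonic.

Local Open Scope ring_scope.

(** * Circulants and the ring Z[x]/(x^N - 1) *)

Section CirculantRing.

Variables (N : nat) (N_gt0 : (0 < N)%N).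
Implicit Types p q : circ_ring N.

Let X : circ_ring N := 'qX.

(** The quotient construction replaces a constant or non-monic modulus by 'X;
    this does not happen here. *)
Lemma mk_monic_XnB1 : mk_monic ('X^N - 1) = 'X^N - 1 :> {poly int}.
Proof.
by rewrite /mk_monic -polyC1 size_XnsubC // monicXnsubC // ltnS N_gt0.
Qed.

Lemma qX_expN : X ^+ N = 1.
Proof.
have h0 : in_qpoly ('X^N - 1 : {poly int}) ('X^N - 1) = 0.
  by apply: val_inj; rewrite /= mk_monic_XnB1 -polyC1 rmodpp // monicXnsubC.
by move/eqP: h0; rewrite rmorphB rmorphXn rmorph1 subr_eq0 => /eqP.
Qed.

Lemma qX_exp_small k : (k < N)%N -> X ^+ k = 'X^k :> {poly int}.
Proof.
move=> ltkN; rewrite /X /qpolyX -rmorphXn in_qpoly_small //.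
by rewrite mk_monic_XnB1 -polyC1 size_XnsubC // size_polyXn ltnS.
Qed.

(** The coefficient index is read modulo N, so that multiplication by x is a
    shift of the index without a case distinction for wrapping around. *)
Definition ccoef p m : int := (p : {poly int})`_(m %% N).

Lemma ccoefB p q m : ccoef (p - q) m = ccoef p m - ccoef q m.
Proof. by rewrite /ccoef coefB. Qed.

Lemma ccoefZ a p m : ccoef (a *: p) m = a * ccoef p m.
Proof. by rewrite /ccoef coefZ. Qed.

Lemma ccoef_sum I (r : seq I) (P : pred I) (F : I -> circ_ring N) m :
  ccoef (\sum_(i <- r | P i) F i) m = \sum_(i <- r | P i) ccoef (F i) m.
Proof. exact: coefn_sum. Qed.

Lemma ccoef_qX k m : ccoef (X ^+ k) m = (m == k %[mod N])%:R.
Proof.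
rewrite {1}(divn_eq k N) exprD mulnC exprM qX_expN expr1n mul1r.
by rewrite /ccoef qX_exp_small ?ltn_pmod // coefXn.
Qed.

Lemma qX_decomposition p : p = \sum_(i < N) (p : {poly int})`_i *: X ^+ i.
Proof.
apply/npolyP => m; rewrite coefn_sum.
have [ltmN | leNm] := ltnP m N; last first.
  have szXN (r : circ_ring N) : (size (r : {poly int}) <= m)%N.
    rewrite (leq_trans _ leNm) // -ltnS (leq_trans (size_mk_monic r)) //.
    by rewrite mk_monic_XnB1 -polyC1 size_XnsubC.
  rewrite nth_default ?szXN // big1 // => i _.
  by rewrite nth_default ?szXN.
rewrite (bigD1 (Ordinal ltmN)) //= big1 ?addr0 => [|i /negPf ne_i].
  by rewrite coefZ qX_exp_small // coefXn eqxx mulr1.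
rewrite coefZ qX_exp_small // coefXn; case: eqP => [e|_]; last by rewrite mulr0.
by case/eqP: ne_i; apply: val_inj.
Qed.

Lemma ccoef_qXM k p m :
  (k <= N)%N -> ccoef (X ^+ k * p) m = ccoef p (m + (N - k)).
Proof.
move=> lekN; rewrite (qX_decomposition p) mulr_sumr !ccoef_sum.
apply: eq_bigr => i _; rewrite -scalerAr -exprD !ccoefZ !ccoef_qX.
congr (_ * (nat_of_bool _)%:R).
by rewrite -(eqn_modDl k (m + _)) addnCA subnKC // modnDr.
Qed.

(** The cyclic convolution formula: by linearity in p it reduces to
    [ccoef_qXM]. *)
Lemma ccoefM p q m :
  ccoef (p * q) m = \sum_(i < N) ccoef p i * ccoef q (m + (N - i)).
Proof.
rewrite {1}(qX_decomposition p) mulr_suml ccoef_sum; apply: eq_bigr => i _.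
by rewrite -scalerAl ccoefZ ccoef_qXM ?(ltnW (ltn_ord i)) // {2}/ccoef modn_small.
Qed.

(** Exponents that are distinct modulo N do not collide, so the coefficients
    are 0 or 1 and are known exactly. *)
Lemma ccoef_sum_qX (s : seq nat) m : uniq [seq (k %% N)%N | k <- s] ->
  ccoef (\sum_(k <- s) X ^+ k) m = ((m %% N)%N \in [seq (k %% N)%N | k <- s])%:R.
Proof.
rewrite ccoef_sum; elim: s => [|k s IHs] /=; first by rewrite big_nil.
case/andP=> k_notin_s /IHs {}IHs; rewrite big_cons IHs ccoef_qX in_cons.
by case: eqP => [->|_]; rewrite ?(negPf k_notin_s) ?addr0 ?add0r.
Qed.

(** Row i of a circulant lists the coefficients of x^i p, so both sides are
    the cyclic convolution of the coefficients of p and q; the rotation of the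
    summation index by i matches them. *)
Lemma circulantM p q : circulant (p * q) = circulant p *m circulant q.
Proof.
apply/matrixP => i k; rewrite !mxE -/(ccoef _ _) ccoefM.
pose rot (j : 'I_N) := Ordinal (ltn_pmod (j + i) N_gt0).
have rot_inj : injective rot.
  move=> j j' [/eqP]; rewrite eqn_modDr !modn_small // => /eqP; exact: val_inj.
rewrite [RHS](reindex_inj rot_inj) /=; apply: eq_bigr => j _.
rewrite !mxE /= -!/(ccoef _ _); congr (_ * _).
  rewrite /ccoef modnDml -addnA subnKC ?modnDr //; exact: ltnW.
congr (_`_ _); apply/eqP; have ltiN := ltn_ord i; have ltjN := ltn_ord j.
(* Adding j + i mod N on both sides removes the truncated subtraction. *)
rewrite -(eqn_modDr ((j + i) %% N)) -[in X in _ == X]addnA subnK; last first.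
  by rewrite ltnW ?ltn_pmod.
rewrite modnDmr modnDr -(modnMDl 2 k); apply/eqP; congr (_ %% _)%N; lia.
Qed.

Lemma circulant_is_zmod_morphism : zmod_morphism (@circulant N).
Proof. by move=> p q; apply/matrixP => i j; rewrite !mxE coefB. Qed.

HB.instance Definition _ :=
  GRing.isZmodMorphism.Build (circ_ring N) 'M[int]_N (@circulant N)
    circulant_is_zmod_morphism.

Variable b : nat.

Lemma decompactificationM (A B : 'M[circ_ring N]_b) :
  decompactification (A *m B) = decompactification A *m decompactification B.
Proof.
rewrite mul_mxblock; apply: eq_mxblock => i j; rewrite mxE raddf_sum.
by apply: eq_bigr => k _; rewrite -circulantM.
Qed.

Lemma decompactification_is_zmod_morphism :
  zmod_morphism (@decompactification N b).
Proof.
move=> A B; rewrite /decompactification -mxblockB; apply: eq_mxblock => i j.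
by rewrite !mxE raddfB.
Qed.

HB.instance Definition _ :=
  GRing.isZmodMorphism.Build _ _ (@decompactification N b)
    decompactification_is_zmod_morphism.

Lemma modn_iota_uniq k l : (l <= N)%N ->
  uniq [seq (i %% N)%N | i <- iota k l].
Proof.
move=> lelN; rewrite map_inj_in_uniq ?iota_uniq // => i j.
rewrite !mem_iota => /andP[leki ltil] /andP[lekj ltjl] /eqP.
rewrite -(subnKC leki) -(subnKC lekj) eqn_modDl !modn_small; lia.
Qed.

Lemma ccoef_all m : ccoef (\sum_(0 <= i < N) X ^+ i) m = 1.
Proof.
rewrite /index_iota subn0 ccoef_sum_qX ?modn_iota_uniq //.
suff /mapP-> // : exists2 i, i \in iota 0 N & (m %% N)%N = (i %% N)%N by [].
by exists (m %% N)%N; rewrite ?mem_iota ?ltn_pmod ?modn_mod.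
Qed.

(** Q J is thus the compact form of the all-ones matrix. *)
Lemma decompactification_const1 :
  decompactification (const_mx (\sum_(0 <= i < N) X ^+ i) : 'M_b) = const_mx 1.
Proof.
rewrite -mxblock_const; apply: eq_mxblock => i j; apply/matrixP => k l.
by rewrite !mxE -/(ccoef _ _) ccoef_all.
Qed.

End CirculantRing.

(** * Strongly regular digraphs and their adjacency matrices *)

Section Digraphs.

Variable v : nat.

Lemma exists_digraph_of_mx (M : 'M[int]_v) :
  (forall i, M i i = 0) -> (forall i j, M i j \in [:: 0; 1]) ->
  exists G : digraph 'I_v, adjacency_matrix G = M.
Proof.
move=> M0 M01; have irr : irreflexive (fun i j => M i j == 1).
  by move=> i; rewrite M0.
exists (Digraph irr); apply/matrixP => i j; rewrite mxE /=.
by have := M01 i j; rewrite !inE => /orP[] /eqP ->.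
Qed.

(** The matrix form of strong regularity: entry (x, y) of the square of the
    adjacency matrix counts the paths x -> z -> y. *)
Lemma dsrg_of_adjacency (G : digraph 'I_v) (k t l m : nat) :
  let A := adjacency_matrix G in
  A *m const_mx 1 = const_mx k%:R :> 'M_v ->
  const_mx 1 *m A = const_mx k%:R :> 'M_v ->
  A *m A = t%:R%:M + A *+ l + (const_mx 1 - 1%:M - A) *+ m ->
  dsrg G v k t l m.
Proof.
move=> A rowA colA sqrA.
have cardE (p : pred 'I_v) : (#|[set z | p z]|)%:R = \sum_z (p z)%:R :> int.
  rewrite cardsE -sum1_card natr_sum big_mkcond; apply: eq_bigr => z _.
  by rewrite unfold_in; case: (p z).
have natI (a b : nat) : a%:R = b%:R :> int -> a = b.
  by move/eqP; rewrite eqr_nat => /eqP.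
have paths2E x y : (paths2 G x y)%:R = (A *m A) x y.
  by rewrite cardE mxE; apply: eq_bigr => z _; rewrite !mxE -natrM mulnb.
have paths2P x y : (paths2 G x y)%:R =
    t%:R *+ (x == y) + (arc G x y)%:R *+ l
    + (1 - (x == y)%:R - (arc G x y)%:R) *+ m :> int.
  by rewrite paths2E sqrA !(mulmxnE, mxE).
split; first by rewrite card_ord.
- move=> x; split; apply: natI; rewrite cardE.
    move/matrixP/(_ x x): rowA; rewrite !mxE => <-.
    by apply: eq_bigr => z _; rewrite !mxE mulr1.
  move/matrixP/(_ x x): colA; rewrite !mxE => <-.
  by apply: eq_bigr => z _; rewrite !mxE mul1r.
- move=> x; apply: natI; rewrite paths2P eqxx arc_irrefl /=; ring.
- by move=> x y /negPf xy xGy; apply: natI; rewrite paths2P xy xGy /=; ring.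
- by move=> x y /negPf xy /negPf xGy; apply: natI; rewrite paths2P xy xGy /=; ring.
Qed.

End Digraphs.

(** * The compact matrix has rank one modulo Q *)

Section RankOne.

Variables (C : comNzRingType) (x : C) (n : nat).
Hypotheses (n_ge2 : (2 <= n)%N) (x_exp : x ^+ (2 * n + 3) = 1).

Definition geom k : C := \sum_(0 <= i < k) x ^+ i.

Let P := geom n.+1.
Let Q := geom (2 * n + 3).
Let R := Q - x ^+ (n - 1) - x ^+ (2 * n + 1).
Let S := Q - 1 - x ^+ 2 - x ^+ (n + 2) - x ^+ (n + 3).

Definition top_row : seq C :=
  [:: 0; P; x * P; x ^+ (n - 1) * P; x ^+ (n - 2) * P;
      x ^+ (2 * n); x * (1 + x ^+ n); x ^+ 2 * P; x * P].

Definition bottom_row : seq C :=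
  [:: Q; 1; x; x ^+ (n - 1); x ^+ (n - 2); R; S; x ^+ 2; x].

(** The integers c_j for which t_j = P w_j + Q c_j. *)
Definition correction : seq C :=
  [:: - n.+1%:R; 0; 0; 0; 0; - n%:R; 1 - n%:R; 0; 0].

Definition is_top (i : 'I_9) : C := (i < 6)%:R.
Definition col_factor (i : 'I_9) : C := if (i < 6)%N then x ^+ i * P else 1.

Lemma exp_period k : x ^+ (k + (2 * n + 3)) = x ^+ k.
Proof. by rewrite exprD x_exp mulr1. Qed.

Lemma geom0 : geom 0 = 0.
Proof. by rewrite /geom big_geq. Qed.

Lemma geomS k : geom k.+1 = geom k + x ^+ k.
Proof. by rewrite /geom big_nat_recr. Qed.

Lemma geom_cat k l : geom (k + l) = geom k + x ^+ k * geom l.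
Proof.
elim: l => [|l IHl]; first by rewrite geom0 mulr0 addn0 addr0.
by rewrite addnS !geomS IHl exprD mulrDr addrA.
Qed.

(** Q is fixed by the powers of x, because x^N = 1 permutes its terms
    cyclically. *)
Lemma expMgeom k : x ^+ k * Q = Q.
Proof.
elim: k => [|k IHk]; first by rewrite mul1r.
rewrite exprSr -mulrA; suff -> : x * Q = Q by [].
have := geom_cat 1 (2 * n + 3); rewrite add1n !geomS geom0 add0r x_exp.
by rewrite addrC => /addrI.
Qed.

Lemma geomMgeom k : geom k * Q = k%:R * Q.
Proof.
elim: k => [|k IHk]; first by rewrite geom0 !mul0r.
by rewrite geomS mulrDl IHk expMgeom -natr1; ring.
Qed.

Let s := x ^+ (n + 2).
Let s' := x ^+ (n + 1).

(** The exponents 0..n of P and n+2..2n+2 of x^(n+2) P cover all residues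
    modulo 2n+3 except n+1.  So P is a unit modulo Q, with inverse - s (1 + s). *)
Lemma half_geom : P * (1 + s) = Q - s'.
Proof.
have -> : Q = P + s' + s * P.
  rewrite /Q (_ : 2 * n + 3 = n.+2 + n.+1)%N; last lia.
  by rewrite geom_cat geomS /s /s' !addn1 addn2.
ring.
Qed.

(** Writing everything in powers of s turns the exponents that depend on n
    into fixed ones. *)
Lemma sqrt_x : s ^+ 2 = x.
Proof.
rewrite /s -exprM (_ : (n + 2) * 2 = 2 * n + 3 + 1)%N; last lia.
by rewrite exprD x_exp mul1r.
Qed.

Lemma mul_sV : s * s' = 1.
Proof. by rewrite /s /s' -exprD -x_exp; congr (_ ^+ _); lia. Qed.

Lemma half_geomMR : P * R = x ^+ (2 * n) + n%:R * Q.
Proof.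
have -> : R = Q - x ^+ (n - 1) * (1 + s).
  rewrite /R mulrDr mulr1 -exprD opprD addrA.
  by congr (_ - _ - x ^+ _); lia.
transitivity (P * Q - x ^+ (n - 1) * (P * (1 + s))); first by ring.
rewrite half_geom geomMgeom mulrBr expMgeom -exprD -natr1.
by rewrite (_ : n - 1 + (n + 1) = 2 * n)%N; [ring | lia].
Qed.

Lemma half_geomMS : P * S = x * (1 + x ^+ n) + (n%:R - 1) * Q.
Proof.
have -> : S = Q - (1 + s * x) * (1 + s).
  rewrite /S -/s (_ : n + 3 = (n + 2).+1)%N; last lia.
  by rewrite (exprSr x (n + 2)) -/s -[in x ^+ 2]sqrt_x -[in s * x]sqrt_x; ring.
transitivity (P * Q - (1 + s * x) * (P * (1 + s))); first by ring.
have -> : x * (1 + x ^+ n) = x + s' by rewrite /s' addn1 exprS; ring.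
have sQ : s * (x * Q) = Q by rewrite -[x]expr1 !expMgeom.
rewrite half_geom geomMgeom -natr1.
transitivity (n%:R * Q + s' - s * (x * Q) + s * s' * x); first by ring.
by rewrite sQ mul_sV; ring.
Qed.

(** Columns 5 and 6 carry the content: R = Q - x^(n-1) (1 + s) and
    S = Q - (1 + s^3) (1 + s) are multiples of 1 + s modulo Q, and
    P (1 + s) = - s^(-1) there. *)
Lemma top_rowE j : (j < 9)%N ->
  top_row`_j = P * bottom_row`_j + Q * correction`_j.
Proof.
have PQ := geomMgeom n.+1; have PR := half_geomMR; have PS := half_geomMS.
do 9?[case: j => [_|j]] => //=; rewrite ?PQ ?PR ?PS; ring.
Qed.

(** As Q p = p(1) Q, this says that w_j has the value 1 - 2 c_j at x = 1. *)
Lemma bottom_rowM_geom j : (j < 9)%N ->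
  Q * bottom_row`_j = Q * (1 - 2 * correction`_j).
Proof.
have QX k : Q * x ^+ k = Q by rewrite mulrC expMgeom.
have QQ : Q * Q = (2 * n + 3)%:R * Q := geomMgeom _.
have Qx : Q * x = Q := QX 1.
rewrite /bottom_row /R /S.
do 9?[case: j => [_|j]] => //=; rewrite ?mulrBr ?QX ?Qx ?QQ; ring.
Qed.

Lemma col_factorM_geom i : Q * col_factor i = Q * (1 + n%:R * is_top i).
Proof.
rewrite /col_factor /is_top; case: ifP => _ /=; last by ring.
by rewrite mulrC -mulrA geomMgeom mulrCA expMgeom -natr1; ring.
Qed.

(** This is where the eigenvalue -3 comes from.  Modulo Q the contribution of P
    has the factor s^2 + s^6 + 2 s, which 1 + s divides: the quotient is
    s (s^4 - s^3 + s^2 - s + 2), and P (1 + s) = - s^(-1) modulo Q. *)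
Lemma row_col_product :
  \sum_(k < 9) bottom_row`_k * col_factor k = (2 * n + 4)%:R * Q - 3.
Proof.
have x3s : x ^+ (n - 1) * x ^+ 3 = s by rewrite -exprD; congr (_ ^+ _); lia.
have x4s : x ^+ (n - 2) * x ^+ 4 = s by rewrite -exprD; congr (_ ^+ _); lia.
have x5R : x ^+ 5 * x ^+ (2 * n) = x ^+ 2.
  by rewrite -exprD -[RHS]exp_period; congr (_ ^+ _); lia.
have sQ k : s ^+ k * Q = Q by rewrite -exprM expMgeom.
have PR : P * R * x ^+ 5 = x ^+ 2 + n%:R * Q.
  by rewrite half_geomMR mulrDl mulrC x5R -mulrA (mulrC Q) expMgeom.
have Sx : S = Q - 1 - x ^+ 2 - s - s * x.
  rewrite /S -/s (_ : n + 3 = (n + 2).+1)%N; last lia.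
  by rewrite (exprSr x (n + 2)).
have Phi : P * (x + x ^+ 3 + s + s) = 2 * Q - (s ^+ 4 - s ^+ 3 + s ^+ 2 - s + 2).
  rewrite -sqrt_x.
  transitivity (P * (1 + s) * (s * (s ^+ 4 - s ^+ 3 + s ^+ 2 - s + 2))).
    by ring.
  rewrite half_geom.
  transitivity (s ^+ 5 * Q - s ^+ 4 * Q + s ^+ 3 * Q - s ^+ 2 * Q + s ^+ 1 * Q * 2
     - s * s' * (s ^+ 4 - s ^+ 3 + s ^+ 2 - s + 2)); first by ring.
  by rewrite mul_sV !sQ; ring.
transitivity (P * Q + P * (x + x ^+ 3 + s + s) + P * R * x ^+ 5
              + (S + x ^+ 2 + x)).
  by rewrite !big_ord_recl big_ord0 /col_factor /= -{1}x3s -x4s; ring.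
rewrite geomMgeom Phi PR Sx -sqrt_x natrD -!natr1; ring.
Qed.

(** Stated over an arbitrary commutative ring, so that the algebra below does not
    see the representation of Z[x]/(x^N - 1) by polynomials. *)
Definition compact_entry (i j : 'I_9) : C :=
  if (i < 6)%N then x ^+ i * top_row`_j else bottom_row`_j.

Lemma compact_entryE i j :
  compact_entry i j =
  col_factor i * bottom_row`_j + Q * (is_top i * correction`_j).
Proof.
rewrite /compact_entry /col_factor /is_top; case: ifP => _ /=; last by ring.
by rewrite top_rowE // mulrDr mulrA (mulrA _ Q) expMgeom; ring.
Qed.

Lemma correction_sum : \sum_(k < 9) correction`_k = - (3 * n)%:R.
Proof. rewrite !big_ord_recl big_ord0 /= -natr1; ring. Qed.

Lemma correction_top_sum : \sum_(k < 9) correction`_k * is_top k = - (2 * n + 1)%:R.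
Proof. rewrite !big_ord_recl big_ord0 /is_top /= -natr1; ring. Qed.

Lemma is_top_sum : \sum_(k < 9) is_top k = 6.
Proof. rewrite !big_ord_recl big_ord0 /is_top /=; ring. Qed.

Lemma geomM_bottom_row_sum :
  Q * (\sum_(k < 9) bottom_row`_k) = Q * (3 * (2 * n + 3))%:R.
Proof.
rewrite mulr_sumr (eq_bigr (fun k : 'I_9 => Q * (1 - 2 * correction`_k)))
  => [|k _]; last exact: bottom_rowM_geom.
rewrite -mulr_sumr sumrB -mulr_sumr correction_sum sumr_const card_ord; ring.
Qed.

Lemma geomM_bottom_row_top_sum :
  Q * (\sum_(k < 9) bottom_row`_k * is_top k) = Q * (4 * n + 8)%:R.
Proof.
rewrite mulr_sumr
  (eq_bigr (fun k : 'I_9 => Q * (is_top k - 2 * (correction`_k * is_top k))))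
  => [|k _]; last by rewrite mulrA bottom_rowM_geom //; ring.
rewrite -mulr_sumr sumrB -mulr_sumr correction_top_sum is_top_sum; ring.
Qed.

Lemma geomM_col_factor_sum :
  Q * (\sum_(k < 9) col_factor k) = Q * (3 * (2 * n + 3))%:R.
Proof.
rewrite mulr_sumr (eq_bigr (fun k : 'I_9 => Q * (1 + n%:R * is_top k))) => [|k _];
  last exact: col_factorM_geom.
rewrite -mulr_sumr big_split -mulr_sumr is_top_sum sumr_const card_ord /=; ring.
Qed.

Lemma geomM_correction_col_factor_sum :
  Q * (\sum_(k < 9) correction`_k * col_factor k) = Q * (- (2 * n * (n + 2))%:R).
Proof.
rewrite mulr_sumr (eq_bigr
    (fun k : 'I_9 => Q * (correction`_k + n%:R * (correction`_k * is_top k))))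
  => [|k _]; last by rewrite mulrCA col_factorM_geom; ring.
rewrite -mulr_sumr big_split -mulr_sumr correction_sum correction_top_sum /=; ring.
Qed.

(** Expanding (v w + Q a c)^2 leaves one product v w carrying the scalar w v,
    and otherwise only multiples of Q, which are determined by the values at
    x = 1. *)
Lemma compact_sqr i j :
  \sum_(k < 9) compact_entry i k * compact_entry k j + compact_entry i j *+ 3 =
  Q *+ (2 * n + 4).
Proof.
have QQ : Q * Q = (2 * n + 3)%:R * Q := geomMgeom _.
under eq_bigr => k _ do rewrite !compact_entryE.
transitivity (
    col_factor i * bottom_row`_j * (\sum_(k < 9) bottom_row`_k * col_factor k)
  + col_factor i * correction`_j * (Q * \sum_(k < 9) bottom_row`_k * is_top k)
  + is_top i * bottom_row`_j * (Q * \sum_(k < 9) correction`_k * col_factor k)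
  + is_top i * correction`_j * (Q * Q) * (\sum_(k < 9) correction`_k * is_top k)
  + compact_entry i j *+ 3).
  congr (_ + _); rewrite !(@mulr_sumr _ 'I_9) -!big_split /=.
  by apply: eq_bigr => k _; ring.
rewrite row_col_product geomM_bottom_row_top_sum geomM_correction_col_factor_sum.
rewrite correction_top_sum QQ compact_entryE.
set a := is_top i; set v := col_factor i.
set w := bottom_row`_j; set c := correction`_j.
have hv : Q * v = Q * (1 + n%:R * a) by exact: col_factorM_geom.
have hw : Q * w = Q * (1 - 2 * c) by exact: bottom_rowM_geom.
have hvw : Q * v * w = Q * (1 + n%:R * a) * (1 - 2 * c).
  by rewrite hv mulrAC hw; ring.
transitivity ((2 * n + 4)%:R * (Q * v * w) + (4 * n + 8)%:R * c * (Q * v)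
   - (2 * n * (n + 2))%:R * a * (Q * w)
   - ((2 * n + 3)%:R * (2 * n + 1)%:R - 3) * Q * a * c); first by ring.
by rewrite hvw hv hw; ring.
Qed.

Lemma compact_row_sum i :
  \sum_(k < 9) compact_entry i k * Q = Q *+ (3 * (2 * n + 3)).
Proof.
have QQ : Q * Q = (2 * n + 3)%:R * Q := geomMgeom _.
under eq_bigr => k _ do rewrite compact_entryE.
transitivity (col_factor i * (Q * \sum_(k < 9) bottom_row`_k)
  + is_top i * (Q * Q) * (\sum_(k < 9) correction`_k)).
  rewrite !(@mulr_sumr _ 'I_9) -!big_split /=.
  by apply: eq_bigr => k _; ring.
rewrite geomM_bottom_row_sum correction_sum QQ mulrA (mulrC _ Q).
rewrite col_factorM_geom; ring.
Qed.

Lemma compact_col_sum j :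
  \sum_(k < 9) Q * compact_entry k j = Q *+ (3 * (2 * n + 3)).
Proof.
have QQ : Q * Q = (2 * n + 3)%:R * Q := geomMgeom _.
under eq_bigr => k _ do rewrite compact_entryE.
transitivity (bottom_row`_j * (Q * \sum_(k < 9) col_factor k)
  + correction`_j * (Q * Q) * (\sum_(k < 9) is_top k)).
  rewrite !(@mulr_sumr _ 'I_9) -!big_split /=.
  by apply: eq_bigr => k _; ring.
rewrite geomM_col_factor_sum is_top_sum QQ mulrA (mulrC _ Q).
rewrite bottom_rowM_geom //; ring.
Qed.

End RankOne.

(** * Elements with coefficients 0 and 1 *)

Section ZeroOne.

Variables (N : nat) (N_gt0 : (0 < N)%N).
Implicit Types p q : circ_ring N.
Let X : circ_ring N := 'qX.

Definition zero_one p := forall m, ccoef p m \in [:: 0; 1].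

Lemma bool_zero_one (b : bool) : b%:R \in [:: 0; 1 : int].
Proof. by case: b. Qed.

Lemma zero_one_sum_qX (s : seq nat) :
  uniq [seq (k %% N)%N | k <- s] -> zero_one (\sum_(k <- s) X ^+ k).
Proof. by move=> s_uniq m; rewrite ccoef_sum_qX //; exact: bool_zero_one. Qed.

(** All coefficients of Q are 1. *)
Lemma zero_one_compl p : zero_one p -> zero_one (geom X N - p).
Proof.
move=> p01 m; rewrite ccoefB ccoef_all //.
by have := p01 m; rewrite !inE => /orP[] /eqP ->.
Qed.

Lemma zero_one_qXM k p : (k <= N)%N -> zero_one p -> zero_one (X ^+ k * p).
Proof. by move=> lekN p01 m; rewrite ccoef_qXM. Qed.

Lemma zero_one_qX k : zero_one (X ^+ k).
Proof. by move=> m; rewrite ccoef_qX //; exact: bool_zero_one. Qed.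

Lemma decompactification_zero_one b (A : 'M[circ_ring N]_b) :
  (forall i j, zero_one (A i j)) ->
  forall i j, decompactification A i j \in [:: 0; 1].
Proof. by move=> A01 i j; rewrite !mxE; apply: A01. Qed.

Lemma decompactification_diag b (A : 'M[circ_ring N]_b) :
  (forall i, ccoef (A i i) 0 = 0) -> forall i, decompactification A i i = 0.
Proof.
move=> A0 i; rewrite !mxE subnKC; last exact: ltnW.
by rewrite modnn; have := A0 (tagnat.sig1 i); rewrite /ccoef mod0n.
Qed.

End ZeroOne.

(** * The compact matrix over Z[x]/(x^N - 1) *)

Section CompactMatrix.

Variables (n : nat) (n_ge2 : (2 <= n)%N).
Local Notation N := (2 * n + 3)%N.
Let X : circ_ring N := 'qX.

Lemma N_gt0 : (0 < N)%N. Proof. by rewrite addn3. Qed.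

Lemma A_mxE i j : A_mx n i j = compact_entry X n i j.
Proof.
rewrite /A_mx /compact_entry /top_row /bottom_row /geom mxE -/X.
have := qX_expN N_gt0; rewrite -/X.
move: X (\sum_(0 <= i < n.+1) X ^+ i) (\sum_(0 <= i < 2 * n + 3) X ^+ i).
move=> x P Q xN; case: i => i lti; case: j => j ltj /=.
have x_n2 : x ^+ n = x ^+ (n - 2) * x ^+ 2 by rewrite -exprD subnK.
have x_n1 : x ^+ (n - 1) = x ^+ (n - 2) * x.
  by rewrite -exprSr; congr (_ ^+ _); lia.
have x_2n : x ^+ (2 * n) = x ^+ (n - 2) * x ^+ (n - 2) * x ^+ 4.
  by rewrite -!exprD; congr (_ ^+ _); lia.
(* The entries 1, x and x^2 of column 5 are x^(2n+3), x^(2n+4) and x^(2n+5). *)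
have wrap k : x ^+ k.+3 * (x ^+ (n - 2) * x ^+ (n - 2) * x ^+ 4) = x ^+ k.
  by rewrite -x_2n -exprD -[RHS](exp_period xN); congr (_ ^+ _); lia.
do 9?[case: i lti => [_ /=|i lti] //]; do 9?[case: j ltj => [_ /=|j ltj] //];
rewrite ?x_2n ?wrap ?(exprD x (2 * n)) ?x_2n ?(exprD x n) ?x_n2 ?x_n1; ring.
Qed.

Lemma A_mx_zero_one i j : zero_one (A_mx n i j).
Proof.
rewrite A_mxE /compact_entry.
have P01 : zero_one (geom X n.+1).
  rewrite /geom /index_iota subn0; apply: zero_one_sum_qX; first exact: N_gt0.
  by apply: modn_iota_uniq; lia.
have pair01 a c : (a < c < N)%N -> zero_one (X ^+ a + X ^+ c).
  move=> /andP[ltac ltcN].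
  have -> : X ^+ a + X ^+ c = \sum_(k <- [:: a; c]) X ^+ k.
    by rewrite !big_cons big_nil addr0.
  apply: zero_one_sum_qX; first exact: N_gt0.
  by rewrite /= !inE !modn_small; lia.
have zero01 : zero_one (0 : circ_ring N) by move=> m; rewrite /ccoef coef0.
have top01 k : zero_one (top_row X n)`_k.
  have expMP a : (a <= N)%N -> zero_one (X ^+ a * geom X n.+1).
    by move=> leaN; apply: zero_one_qXM => //; exact: N_gt0.
  rewrite /top_row; do 9?[case: k => [|k]] => //=;
    rewrite ?nth_nil //; try by apply: expMP; lia.
  - by apply: (expMP 1); lia.
  - exact: zero_one_qX N_gt0 _.
  - apply: (zero_one_qXM N_gt0 (k := 1)); first lia.
    by apply: (pair01 0); lia.
  - by apply: (expMP 1); lia.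
have bottom01 k : zero_one (bottom_row X n)`_k.
  have qX01 := zero_one_qX N_gt0.
  rewrite /bottom_row; do 9?[case: k => [|k]] => //=; rewrite ?nth_nil //.
  - by rewrite -[geom _ _]subr0; apply: zero_one_compl => //; exact: N_gt0.
  - exact: (qX01 0).
  - exact: (qX01 1).
  - rewrite -addrA -opprD; apply: zero_one_compl; first exact: N_gt0.
    by apply: pair01; lia.
  - have -> : geom X N - 1 - X ^+ 2 - X ^+ (n + 2) - X ^+ (n + 3)
            = geom X N - \sum_(k <- [:: 0; 2; n + 2; n + 3]%N) X ^+ k.
      by rewrite !big_cons big_nil expr0; ring.
    apply: zero_one_compl; first exact: N_gt0.
    apply: zero_one_sum_qX; first exact: N_gt0.
    by rewrite /= !inE !modn_small; lia.
  - exact: (qX01 1).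
case: ifP => [lti6 | _] //; apply: zero_one_qXM => //; [exact: N_gt0 | lia].
Qed.

(** A diagonal entry x^a P with 0 < a <= n + 2 has the exponents a..a+n, which
    stay strictly between 0 and 2n+3. *)
Lemma A_mx_diag i : ccoef (A_mx n i i) 0 = 0.
Proof.
have hN := N_gt0.
have hP a : (0 < a <= n + 2)%N -> ccoef (X ^+ a * geom X n.+1) 0 = 0.
  move=> ha; rewrite ccoef_qXM //; last lia.
  rewrite /geom /index_iota subn0 ccoef_sum_qX //; last first.
    by apply: modn_iota_uniq; lia.
  rewrite add0n; case: mapP => // -[k]; rewrite mem_iota => hk.
  rewrite !modn_small; lia.
have hX a : (0 < a < N)%N -> ccoef (X ^+ a) 0 = 0.
  by move=> ha; rewrite ccoef_qX // mod0n modn_small; [case: a ha | lia].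
rewrite A_mxE /compact_entry; case: i => i /=; do 9?[case: i => [_ /=|i]] => //.
- by rewrite mulr0 /ccoef coef0.
- by apply: hP; lia.
- by rewrite mulrA -exprSr; apply: hP; lia.
- by rewrite mulrA -exprD; apply: hP; lia.
- by rewrite mulrA -exprD; apply: hP; lia.
- rewrite -exprD (_ : 5 + 2 * n = 2 + N)%N; last lia.
  by rewrite (exp_period (qX_expN hN)); apply: hX; lia.
- have h1 : ccoef (1 : circ_ring N) 0 = 1.
    by rewrite -(expr0 X) ccoef_qX // eqxx.
  by rewrite !ccoefB ccoef_all // h1 !hX ?subrr ?subr0; lia.
- by apply: hX; lia.
- by apply: (hX 1); lia.
Qed.

(** Q J in the notation of the opening comment. *)
Definition ones_mx : 'M[circ_ring N]_9 := const_mx (geom X N).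

Lemma decompactification_ones_mxMn k :
  decompactification (ones_mx *+ k) = const_mx k%:R.
Proof.
rewrite raddfMn /= (decompactification_const1 N_gt0).
by apply/matrixP => i j; rewrite mulmxnE !mxE.
Qed.

Lemma A_mx_sqr : A_mx n *m A_mx n + A_mx n *+ 3 = ones_mx *+ (2 * n + 4).
Proof.
apply/matrixP => i j; rewrite [LHS]mxE [in RHS]mulmxnE [in RHS]mxE.
rewrite -(compact_sqr n_ge2 (qX_expN N_gt0) i j) mulmxnE A_mxE mxE.
by congr (_ + _); apply: eq_bigr => k _; rewrite !A_mxE.
Qed.

Lemma A_mx_row_sum : A_mx n *m ones_mx = ones_mx *+ (3 * N).
Proof.
apply/matrixP => i j; rewrite mulmxnE !mxE.
rewrite -(compact_row_sum n_ge2 (qX_expN N_gt0) i).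
by apply: eq_bigr => k _; rewrite A_mxE mxE.
Qed.

Lemma A_mx_col_sum : ones_mx *m A_mx n = ones_mx *+ (3 * N).
Proof.
apply/matrixP => i j; rewrite mulmxnE !mxE.
rewrite -(compact_col_sum n_ge2 (qX_expN N_gt0) j).
by apply: eq_bigr => k _; rewrite A_mxE mxE.
Qed.

Lemma decompactification_A_mx_dsrg (G : digraph 'I_(\sum_(i < 9) N)) :
  adjacency_matrix G = decompactification (A_mx n) ->
  dsrg G (9 * N) (3 * N) (2 * n + 4) (2 * n + 1) (2 * n + 4).
Proof.
move=> defG; rewrite (_ : 9 * N = \sum_(i < 9) N)%N; last first.
  by rewrite sum_nat_const card_ord.
have ones1 : decompactification ones_mx = const_mx 1.
  exact: decompactification_const1 N_gt0 _.
apply: dsrg_of_adjacency; rewrite defG.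
- by rewrite -ones1 -(decompactificationM N_gt0) A_mx_row_sum
     decompactification_ones_mxMn.
- by rewrite -ones1 -(decompactificationM N_gt0) A_mx_col_sum
     decompactification_ones_mxMn.
have := congr1 (@decompactification _ _) A_mx_sqr.
rewrite raddfD raddfMn /= decompactification_ones_mxMn.
rewrite decompactificationM ?N_gt0 //.
move: (decompactification (A_mx n)) => M sqrM.
rewrite -[LHS](addrK (M *+ 3)) sqrM; apply/matrixP => i j.
by rewrite !(mulmxnE, mxE); ring.
Qed.

End CompactMatrix.

Local Close Scope ring_scope.

(* The vertex set is 'I_(\sum_(i < 9) (2 * n + 3)), the index type of the block
   matrix; its cardinality 9 * (2 * n + 3) is part of dsrg. *)
Theorem theorem7 (n : nat) (hn : 2 <= n) :
  exists G : digraph 'I_(\sum_(i < 9) (2 * n + 3)),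
    adjacency_matrix G = decompactification (A_mx n) /\
    dsrg G (9 * (2 * n + 3)) (3 * (2 * n + 3)) (2 * n + 4) (2 * n + 1) (2 * n + 4).
Proof.
have [G defG] := exists_digraph_of_mx
  (decompactification_diag (A_mx_diag hn))
  (decompactification_zero_one (A_mx_zero_one hn)).
by exists G; split; last exact: decompactification_A_mx_dsrg.
Qed.
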